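(* In the nonobligatory-inspection single-item selection problem described in the context, every policy $\pi$ satisfies $\mathbb{E}[C^\pi]\ge \mathbb{E}\big[\min_{n\in[N]} W^{\mathsf{NOI}}_n\big]$. Consequently the optimal expected cost satisfies $\inf_\pi \mathbb{E}[C^\pi]\ge \mathbb{E}\big[\min_{n\in[N]} W^{\mathsf{NOI}}_n\big]$.
   Context: There are $N$ items indexed by $n\in[N]=\{1,\dots,N\}$. Item $n$ has a known inspection cost $c_n\ge 0$ and a hidden price $V_n\ge 0$ drawn from a known distribution $G_n$ with finite mean $\mu_n$; the $V_n$ are mutually independent. A (nonobligatory-inspection) policy adaptively proceeds in rounds: in each round it either inspects an as-yet-uninspected item $n$, paying $c_n$ and learning the realization of $V_n$, or selects one item (inspected or not) and stops. Its total cost is $C^\pi=\sum_n(\mathbb{S}_n V_n+\mathbb{I}_n c_n)$ where $\mathbb{S}_n,\mathbb{I}_n$ indicate that $n$ is selected, respectively inspected; exactly one item is selected, and selection need not be preceded by inspection. For each item, define the reservation price $u^{\mathsf{rsv}}_n$ and backup price $u^{\mathsf{bkp}}_n$ by $\mathbb{E}[(u^{\mathsf{rsv}}_n-V_n)^+]=c_n$ and $\mathbb{E}[(V_n-u^{\mathsf{bkp}}_n)^+]=c_n$ (in general $u^{\mathsf{rsv}}_n=\sup\{u:\mathbb{E}[(u-V_n)^+]\le c_n\}$, $u^{\mathsf{bkp}}_n=\inf\{u:\mathbb{E}[(V_n-u)^+]\le c_n\}$). Let $W^{\mathsf{OI}}_n=\max\{V_n,u^{\mathsf{rsv}}_n\}$,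 and let $W^{\mathsf{NOI}}_n=\min\{W^{\mathsf{OI}}_n,u^{\mathsf{bkp}}_n\}$ if $u^{\mathsf{rsv}}_n<u^{\mathsf{bkp}}_n$ and $W^{\mathsf{NOI}}_n=\mu_n$ otherwise. *)

(* Defs.v *)
From HB Require Import structures.
From mathcomp Require Import all_boot all_order all_algebra.
From mathcomp Require Import all_classical all_reals all_analysis.
Set Implicit Arguments. Unset Strict Implicit. Unset Printing Implicit Defensive.
Import Order.TTheory GRing.Theory Num.Def Num.Theory.
Local Open Scope classical_set_scope.
Local Open Scope ring_scope.

Inductive action (N : nat) : Type :=
| Inspect of 'I_N
| Select of 'I_N.

Definition history (R : realType) (N : nat) := seq ('I_N * R).

Definition policy (R : realType) (N : nat) := history R N -> action N.

Section Defs.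
Context {d : measure_display} {T : measurableType d} {R : realType}
  (P : probability T R) {N : nat}.

Definition mutually_independent (V : 'I_N -> T -> R) : Prop :=
  forall B : 'I_N -> set R, (forall n, measurable (B n)) ->
    P (\bigcap_(n in [set: 'I_N]) (V n @^-1` B n)) =
    (\prod_(n < N) P (V n @^-1` B n))%E.

Definition observe (V : 'I_N -> T -> R) (s : seq 'I_N) (w : T) : history R N :=
  [seq (m, V m w) | m <- s].

Definition sigma_of (V : 'I_N -> T -> R) (s : seq 'I_N) : set (set T) :=
  <<s [set A : set T | exists (m : 'I_N) (B : set R),
        m \in s /\ measurable B /\ A = V m @^-1` B] >>.

Definition valid_policy (pi : policy R N) : Prop :=
  forall (h : history R N) (n : 'I_N), pi h = Inspect n -> n \notin map fst h.

Definition measurable_policy (V : 'I_N -> T -> R) (pi : policy R N) : Prop :=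
  forall (s : seq 'I_N) (a : action N),
    sigma_of V s [set w | pi (observe V s w) = a].

Fixpoint run (pi : policy R N) (v : 'I_N -> R) (fuel : nat) (h : history R N)
  : history R N * option 'I_N :=
  match fuel with
  | 0 => (h, None)
  | k.+1 =>
    match pi h with
    | Select n => (h, Some n)
    | Inspect n => run pi v k (rcons h (n, v n))
    end
  end.

(* Total cost C^pi: inspection costs plus price of the selected item.  A valid
   policy makes at most N inspections, so N+1 rounds always end in a selection. *)
Definition cost (c : 'I_N -> R) (V : 'I_N -> T -> R) (pi : policy R N) (w : T) : R :=
  let hs := run pi (fun n => V n w) N.+1 [::] in
  \sum_(p <- hs.1) c p.1 +
  (match hs.2 with Some n => V n w | None => 0 end).

Definition expected_cost (c : 'I_N -> R) (V : 'I_N -> T -> R) (pi : policy R N) : \bar R :=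
  (\int[P]_w (cost c V pi w)%:E)%E.

End Defs.

Section Indices.
Context {d : measure_display} {T : measurableType d} {R : realType}
  (P : probability T R).

Definition u_rsv (c : R) (V : T -> R) : \bar R :=
  ereal_sup [set u%:E | u in [set u : R | (\int[P]_w (Num.max (u - V w) 0)%:E <= c%:E)%E]].

(* backup price: inf {u : E[(V - u)^+] <= c} (may be +oo) *)
Definition u_bkp (c : R) (V : T -> R) : \bar R :=
  ereal_inf [set u%:E | u in [set u : R | (\int[P]_w (Num.max (V w - u) 0)%:E <= c%:E)%E]].

Definition mean (V : T -> R) : \bar R := (\int[P]_w (V w)%:E)%E.

Definition W_OI (c : R) (V : T -> R) (w : T) : \bar R :=
  Order.max (V w)%:E (u_rsv c V).

Definition W_NOI (c : R) (V : T -> R) (w : T) : \bar R :=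
  if (u_rsv c V < u_bkp c V)%E then Order.min (W_OI c V w) (u_bkp c V) else mean V.

End Indices.

(* Main.v *)
Require Import Defs.
From HB Require Import structures.
From mathcomp Require Import all_boot all_order all_algebra.
From mathcomp Require Import all_classical all_reals all_analysis.
From mathcomp Require Import measurable_realfun lra.
Import Order.TTheory GRing.Theory Num.Def Num.Theory.
Local Open Scope classical_set_scope.
Local Open Scope ring_scope.

(** For one item with surrogate [W] and any outside option [x >= 0],
    [E[min(x, W)] <= E[min(x, V)] + c] and [E[W] <= mean V]: replacing an
    uninspected item by its surrogate never costs more than inspecting it, nor
    than selecting it blindly.  Let the potential of an inspected set [s] be the
    minimum over all items of the price (inside [s]) or of the surrogate
    (outside).  Since the next inspected item is independent of the history and
    of the other items, the two inequalities, with [x] the minimum over the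
    other items, show that on every event determined by the history the
    expected cost is at least the cost already paid plus the potential.  At the
    empty history this is the claim. *)

(** * Reservation and backup prices of one item, and its two surrogate inequalities *)

Section Item.
Context {d : measure_display} {T : measurableType d} {R : realType}.
Variable P : probability T R.

Lemma integral_prob_cst (a : \bar R) : (\int[P]_w a = a)%E.
Proof.
have := integral_cst P measurableT a; rewrite /cst => ->.
rewrite -[RHS]mule1; congr (_ * _)%E; exact: probability_setT.
Qed.

Lemma le_integral_add (f : T -> \bar R) (g h : T -> \bar R) :
  measurable_fun setT f -> measurable_fun setT g -> measurable_fun setT h ->
  (forall w, 0 <= f w)%E -> (forall w, 0 <= g w)%E -> (forall w, 0 <= h w)%E ->
  (forall w, f w <= g w + h w)%E ->
  (\int[P]_w f w <= \int[P]_w g w + \int[P]_w h w)%E.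
Proof.
move=> mf mg mh f0 g0 h0 fgh; rewrite -ge0_integralD//=.
by apply: ge0_le_integral => //; exact: emeasurable_funD.
Qed.

Variables (c : R) (V : T -> R).
Hypotheses (c0 : 0 <= c) (mV : measurable_fun setT V) (V0 : forall w, 0 <= V w).
Hypothesis iV : P.-integrable setT (EFin \o V).

Let mean_fin : mean P V \is a fin_num.
Proof. exact: integrable_fin_num. Qed.

Let measurable_EV : measurable_fun setT (fun w => (V w)%:E).
Proof. exact/measurable_EFinP. Qed.

Let EV_ge0 w : (0 <= (V w)%:E)%E.
Proof. by rewrite lee_fin. Qed.

Lemma mean_ge0 : (0 <= mean P V)%E.
Proof. by apply: integral_ge0 => w _. Qed.

Let excess u : \bar R := (\int[P]_w (Num.max (V w - u) 0)%:E)%E.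

Let pos_ge0 (a : R) : (0 <= (Num.max a 0)%:E)%E.
Proof. by rewrite lee_fin le_max lexx orbT. Qed.

Let measurable_shortfall u :
  measurable_fun setT (fun w => (Num.max (u - V w) 0)%:E).
Proof.
by apply/measurable_EFinP; apply: measurable_maxr => //; exact: measurable_funB.
Qed.

Let measurable_excess u :
  measurable_fun setT (fun w => (Num.max (V w - u) 0)%:E).
Proof.
by apply/measurable_EFinP; apply: measurable_maxr => //; exact: measurable_funB.
Qed.

(** The value [u = 0] is admissible because [V >= 0], and [u <= V + (u - V)^+] bounds every
    admissible [u] by the mean plus [c], so the supremum is finite. It satisfies the constraint
    itself because the shortfall [(u - V)^+] is 1-Lipschitz in [u]. *)
Lemma u_rsvP : exists r, [/\ 0 <= r, u_rsv P c V = r%:E &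
  (\int[P]_w (Num.max (r - V w) 0)%:E <= c%:E)%E].
Proof.
have rsv_ge0 : (0 <= u_rsv P c V)%E.
  apply: ereal_sup_ubound; exists 0 => //=.
  rewrite (eq_integral (fun=> 0%E)) ?integral0 ?lee_fin// => w _.
  by rewrite /Num.max; case: ltP => // ?; congr EFin; have := V0 w; lra.
have rsv_le : (u_rsv P c V <= mean P V + c%:E)%E.
  apply: ge_ereal_sup => _ /= [u cu <-].
  case: (leP u 0) => [u0|u0].
    by rewrite (@le_trans _ _ 0%E) ?lee_fin// adde_ge0// mean_ge0.
  apply: (le_trans _ (leeD2l _ cu)).
  rewrite -(integral_prob_cst u%:E).
  apply: le_integral_add => // [w|w]; first by rewrite lee_fin ltW.
  by rewrite -EFinD lee_fin /Num.max; case: ltP => ?; lra.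
have rsv_fin : u_rsv P c V \is a fin_num.
  rewrite ge0_fin_numE// (le_lt_trans rsv_le)// lte_add_pinfty ?ltry//.
  by rewrite ltey_eq mean_fin.
have [r rE] : exists r, u_rsv P c V = r%:E.
  by exists (fine (u_rsv P c V)); rewrite fineK.
exists r; split=> //; first by rewrite -lee_fin -rE.
apply/lee_addgt0Pr => e e0.
have [_ [u /= cu <-]] := ub_ereal_sup_adherent e0 rsv_fin.
rewrite -/(u_rsv P c V) rE -EFinB lte_fin => ru.
apply: le_trans (leeD2r _ cu).
rewrite -(integral_prob_cst e%:E).
apply: le_integral_add => // w; first by rewrite lee_fin ltW.
by rewrite -EFinD lee_fin /Num.max; do 2 case: ltP => ?; lra.
Qed.

(** Each [b - e] lies below the infimum, so its excess is at least [c]; raising it to [b] lowers the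
    excess by at most [e]. *)
Lemma le_excess_u_bkp b : u_bkp P c V = b%:E ->
  (c%:E <= \int[P]_w (Num.max (V w - b) 0)%:E)%E.
Proof.
move=> bE; apply/lee_addgt0Pr => e e0.
have : (c%:E <= excess (b - e))%E.
  rewrite leNgt; apply/negP => ec.
  have : (u_bkp P c V <= (b - e)%:E)%E.
    by apply: ereal_inf_lbound; exists (b - e) => //=; exact: ltW.
  by rewrite bE lee_fin; lra.
move=> /le_trans; apply; rewrite -(integral_prob_cst e%:E).
apply: le_integral_add => // w; first by rewrite lee_fin ltW.
by rewrite -EFinD lee_fin /Num.max; do 2 case: ltP => ?; lra.
Qed.

(** No integer [k] is admissible, so [c] is at most the excess over every [k], which tends to 0 by
    dominated convergence with bound [V]. *)
Lemma u_bkp_pinfty_cost0 : u_bkp P c V = +oo%E -> c = 0.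
Proof.
move=> bE; apply/eqP; rewrite eq_le c0 andbT -lee_fin.
have cvV : (excess k%:R @[k --> \oo] --> 0)%E.
  have [|||||_ _] := @dominated_convergence _ _ _ P _ measurableT
    (fun k w => (Num.max (V w - k%:R) 0)%:E) (fun=> 0%E) (EFin \o V).
  - by [].
  - by [].
  - apply: aeW => w _; apply: cvg_near_cst.
    near=> k; congr EFin; rewrite /Num.max; case: ltP => // kV.
    have : V w <= k%:R.
      by near: k; exists (Num.bound (V w)) => // n /= nV;
         rewrite (le_trans (ltW (archi_boundP (V0 w))))// ler_nat.
    by have := V0 w; lra.
  - exact: iV.
  - apply: aeW => w n _; rewrite gee0_abs// lee_fin ge_max V0 andbT.
    by rewrite lerBlDr lerDl.
  by rewrite integral0.
suff : (c%:E <= limn (fun k => excess k%:R))%E by rewrite (cvg_lim _ cvV).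
apply: lime_ge; first by apply/cvg_ex; exists 0%E.
near=> k.
rewrite leNgt; apply/negP => ec.
have : (u_bkp P c V <= k%:R%:E)%E.
  by apply: ereal_inf_lbound; exists k%:R => //=; exact: ltW.
by rewrite bE leye_eq.
Unshelve. all: by end_near. Qed.

(** Writing the surrogate as a nonnegative measurable function of the price lets it inherit
    measurability and independence from [V], also for smaller sigma-algebras. *)
Lemma W_NOI_comp : exists phi : R -> \bar R,
  [/\ measurable_fun setT phi, forall y, (0 <= phi y)%E &
      forall w, W_NOI P c V w = phi (V w)].
Proof.
have [r [r0 rE _]] := u_rsvP.
exists (fun y => if (u_rsv P c V < u_bkp P c V)%E
  then mine (maxe y%:E (u_rsv P c V)) (u_bkp P c V) else mean P V); split.
- case: (u_rsv P c V < u_bkp P c V)%E => //.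
  apply: measurable_mine => //; apply: measurable_maxe => //.
- move=> y; case: ifP => [rb|_]; last exact: mean_ge0.
  rewrite le_min le_max rE !lee_fin r0 orbT/=.
  by move: rb; rewrite rE => /ltW; apply: le_trans; rewrite lee_fin.
- by move=> w.
Qed.

Lemma measurable_W_NOI : measurable_fun setT (W_NOI P c V).
Proof.
have [phi [mphi _ phiE]] := W_NOI_comp.
rewrite (_ : W_NOI P c V = phi \o V); first exact: measurableT_comp.
by apply/funext => w /=.
Qed.

Lemma W_NOI_ge0 w : (0 <= W_NOI P c V w)%E.
Proof. by have [phi [_ phi0 ->]] := W_NOI_comp. Qed.

Lemma integral_W_NOI_le_mean : (\int[P]_w W_NOI P c V w <= mean P V)%E.
Proof.
have [r [r0 rE rc]] := u_rsvP.
case: (ltP (u_rsv P c V) (u_bkp P c V)) => [rb|br]; last first.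
  rewrite (eq_integral (fun=> mean P V)) ?integral_prob_cst// => w _.
  by rewrite /W_NOI ltNge br.
move: (rb); case bE : (u_bkp P c V) => [b| |] rb'.
- have : (\int[P]_w W_NOI P c V w + c%:E <= mean P V + c%:E)%E.
    apply: (le_trans (leeD2l _ (le_excess_u_bkp _ bE))).
    apply: (le_trans _ (leeD2l _ rc)).
    rewrite -!ge0_integralD//=; last 2 first.
    + by move=> w _; exact: W_NOI_ge0.
    + exact: measurable_W_NOI.
    (* For [r < b] the pointwise identity [W + (V - b)^+ = V + (r - V)^+] holds; the shortfall at
       [r] costs at most [c] and the excess at [b] at least [c]. *)
    rewrite le_eqVlt; apply/orP; left; apply/eqP.
    apply: eq_integral => w _.
    rewrite /W_NOI rb /W_OI rE bE -EFin_max -EFin_min -!EFinD; congr EFin.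
    move: rb'; rewrite rE lte_fin => rb'.
    rewrite /Num.max /Num.min; case: (ltP (V w) r) => ?;
      by do ?case: ltP => ?; lra.
  by rewrite leeD2rE.
(* With an infinite backup price, [W = V + (r - V)^+], whose mean exceeds that of [V] by at most
   [c], and here [c = 0]. *)
- apply: (@le_trans _ _ (mean P V + \int[P]_w (maxr (r - V w) 0)%:E)%E).
    apply: le_integral_add => //.
    + exact: measurable_W_NOI.
    + by move=> w; exact: W_NOI_ge0.
    + move=> w; rewrite /W_NOI rb /W_OI rE bE miney -EFin_max -!EFinD lee_fin.
      by rewrite /Num.max; do ?case: ltP => ?; lra.
  apply: (le_trans (leeD2l _ rc)).
  by rewrite (u_bkp_pinfty_cost0 bE) adde0.
- by move: rb'; rewrite rE.
Qed.

Lemma integral_min_W_NOI_le (x : \bar R) : (0 <= x)%E ->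
  (\int[P]_w mine x (W_NOI P c V w) <=
     \int[P]_w mine x (V w)%:E + c%:E)%E.
Proof.
move=> x0.
have [r [r0 rE rc]] := u_rsvP.
have mm : measurable_fun setT (fun w => mine x (V w)%:E).
  exact: measurable_mine.
have m0 w : (0 <= mine x (V w)%:E)%E by rewrite le_min x0 EV_ge0.
case: (ltP (u_rsv P c V) (u_bkp P c V)) => [rb|br].
  apply: (le_trans _ (leeD2l _ rc)); apply: le_integral_add => //.
  - by apply: measurable_mine => //; exact: measurable_W_NOI.
  - by move=> w; rewrite le_min x0 W_NOI_ge0.
  - move=> w; rewrite /W_NOI rb /W_OI rE.
    apply: (@le_trans _ _ (mine x (maxe (V w)%:E r%:E))).
      by rewrite le_min !ge_min lexx /= lexx !orbT.
    (* The value [x = +oo] does occur: with a single item, the minimum over the other items is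
       empty. *)
    case: x x0 {mm m0} => [x| |] // x0.
      rewrite -EFin_max -!EFin_min -EFinD lee_fin.
      rewrite /Num.max /Num.min; case: (ltP (V w) r) => ?;
        by do ?case: ltP => ?; lra.
    rewrite !minye -EFin_max -EFinD lee_fin.
    rewrite /Num.max /Num.min; case: (ltP (V w) r) => ?;
      by do ?case: ltP => ?; lra.
rewrite (eq_integral (fun=> mine x (mean P V))); last first.
  by move=> w _; rewrite /W_NOI ltNge br.
rewrite integral_prob_cst.
(* The surrogate is now the constant mean. If [x <= r], then [x <= min(x, V) + (r - V)^+] bounds the
   minimum through its first argument. *)
case: (leP x (u_rsv P c V)) => [xr|rx].
  rewrite ge_min; apply/orP; left.
  apply: (le_trans _ (leeD2l _ rc)); rewrite -[leLHS](integral_prob_cst x).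
  apply: le_integral_add => // w.
  move: xr; rewrite rE; case: x x0 {mm m0} => [x| |] // x0 xr.
  move: xr; rewrite -EFin_min -EFinD !lee_fin => xr.
  by rewrite /Num.max /Num.min; do ?case: ltP => ?; lra.
rewrite ge_min; apply/orP; right.
(* Since [b <= r < x], some admissible [u] lies below [x], and [V <= min(x, V) + (V - u)^+] bounds
   the mean. *)
have [_ [u /= cu <-] ux] := ereal_inf_lt (le_lt_trans br rx).
apply: (le_trans _ (leeD2l _ cu)).
apply: le_integral_add => // w.
case: x x0 ux {mm m0 rx} => [x| |] // x0 ux.
  move: ux; rewrite -EFin_min -EFinD !lee_fin lte_fin => ux.
  by rewrite /Num.max /Num.min; do ?case: ltP => ?; lra.
by rewrite minye -EFinD lee_fin /Num.max; do ?case: ltP => ?; lra.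
Qed.
End Item.

(** * Tonelli for a pair of independent random elements *)

Section IndependentFubini.
Context {d d1 d2 : measure_display} {T : measurableType d}
  {T1 : measurableType d1} {T2 : measurableType d2} {R : realType}.
Variables (P : probability T R) (X : {mfun T >-> T1}) (Y : {mfun T >-> T2}).
Hypothesis indepXY : forall A B, measurable A -> measurable B ->
  P (X @^-1` A `&` Y @^-1` B) = (P (X @^-1` A) * P (Y @^-1` B))%E.

(** Independence makes the joint law agree with the product of the laws on rectangles, hence
    everywhere, and Tonelli applies to the product. *)
Lemma integral_independent_pair (h : T1 * T2 -> \bar R) :
  measurable_fun setT h -> (forall z, 0 <= h z)%E ->
  (\int[P]_w h (X w, Y w) = \int[P]_w \int[P]_w' h (X w, Y w'))%E.
Proof.
move=> mh h0.
have mXY : measurable_fun setT (fun w => (X w, Y w)).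
  by apply: measurable_fun_pair; exact: measurable_funPT.
pose XY : {mfun T >-> (T1 * T2)%type} := mfun_Sub (mem_set mXY).
have prodE A : measurable A ->
    (distribution P X \x distribution P Y)%E A = distribution P XY A.
  apply: product_measure_unique => B C mB mC.
  by rewrite -(indepXY _ _ mB mC).
rewrite -[LHS](@ge0_integral_distribution _ _ _ _ _ P XY)//.
rewrite -(eq_measure_integral _ (fun A mA _ => prodE A mA)).
rewrite fubini_tonelli1// ge0_integral_distribution//=; last 2 first.
- exact: measurable_fun_fubini_tonelli_F.
- by move=> x; exact: integral_ge0.
apply: eq_integral => w _; rewrite /fubini_F/=.
by rewrite ge0_integral_distribution//; exact: measurable_fun_pair2.
Qed.
End IndependentFubini.

(** * Sigma-algebras of observed prices, and independence of an unobserved one *)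

Section SigmaOf.
Context {d : measure_display} {T : measurableType d} {R : realType} {N : nat}.
Variables (P : probability T R) (V : 'I_N -> T -> R).
Hypothesis mV : forall n, measurable_fun setT (V n).

(* [sigma_of V s] is by definition the sigma-algebra generated by this family;
   naming the family gives access to [g_sigma_algebraType (sigma_gen s)]. *)
Definition sigma_gen (s : seq 'I_N) : set (set T) :=
  [set A : set T | exists (m : 'I_N) (B : set R),
        m \in s /\ measurable B /\ A = V m @^-1` B].

Lemma measurable_sigma_of s A : sigma_of V s A -> measurable A.
Proof.
move: A; apply: smallest_sub; first exact: sigma_algebra_measurable.
by move=> _ [m [B [_ [mB ->]]]]; rewrite -[X in measurable X]setTI; exact: mV.
Qed.

Lemma sub_sigma_of s s' : {subset s <= s'} -> sigma_of V s `<=` sigma_of V s'.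
Proof.
move=> ss'; apply: sub_sigma_algebra2 => A [m [B [ms mB]]].
by exists m, B; split => //; exact: ss'.
Qed.

Lemma sigma_of_measurable_coord s m : m \in s ->
  measurable_fun (setT : set (g_sigma_algebraType (sigma_gen s))) (V m).
Proof.
move=> ms _ B mB; rewrite setTI; apply: sub_sigma_algebra.
by exists m, B.
Qed.

(** For fixed [B], both sides are finite measures in [A]. They agree on an intersection-closed
    family that generates a sigma-algebra containing [sigma_of V s]. *)
Lemma sigma_of_independent n s A B : mutually_independent P V ->
  n \notin s -> sigma_of V s A -> measurable B ->
  P (A `&` V n @^-1` B) = (P A * P (V n @^-1` B))%E.
Proof.
move=> indV ns sA mB.
have mVB m (C : set R) : measurable C -> measurable (V m @^-1` C).
  by move=> mC; rewrite -[X in measurable X]setTI; exact: mV.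
(* [G] consists of the cylinders that leave coordinate [n] free. *)
pose G : set (set T) := [set A | exists C : 'I_N -> set R,
  [/\ forall m, measurable (C m), C n = setT &
      A = \bigcap_(m in [set: 'I_N]) (V m @^-1` C m)]].
have GT : G setT.
  exists (fun=> setT); split => //.
  by apply/seteqP; split.
have mG : G `<=` measurable.
  move=> _ [C [mC _ ->]].
  by apply: fin_bigcap_measurable => // m _; exact: mVB.
have GI : setI_closed G.
  move=> _ _ [C [mC nC ->]] [D [mD nD ->]].
  exists (fun m => C m `&` D m); split.
  - by move=> m; exact: measurableI.
  - by rewrite nC nD setTI.
  - by rewrite -bigcapI; apply: eq_bigcapr => m _; rewrite preimage_setI.
have sG : sigma_of V s `<=` <<s G >>.
  apply: sub_sigma_algebra2 => _ [m [C [ms [mC ->]]]].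
  exists (fun k => if k == m then C else setT); split.
  - by move=> k; case: ifP.
  - by case: eqP => // nm; move: ns; rewrite nm ms.
  - apply/seteqP; split => [w Cw k _ /=|w /(_ m I)/=]; last by rewrite eqxx.
    by case: eqP => // ->.
have PB0 : 0 <= fine (P (V n @^-1` B)) by exact: fine_ge0.
rewrite muleC -(@fineK _ (P (V n @^-1` B))); last first.
  by apply: fin_num_measure; exact: mVB.
rewrite -[RHS]/(mscale (NngNum PB0) P A) -[LHS]/(mrestr P (mVB n B mB) A).
apply: (g_sigma_algebra_measure_unique G mG (fun=> setT)) => //.
- by rewrite bigcup_const.
- move=> _ [C [mC nC ->]].
  rewrite -[LHS]/(P (\bigcap_(m in [set: 'I_N]) (V m @^-1` C m) `&`
    V n @^-1` B)) -[RHS]/((fine (P (V n @^-1` B)))%:E *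
    P (\bigcap_(m in [set: 'I_N]) (V m @^-1` C m)))%E fineK; last first.
    by apply: fin_num_measure; exact: mVB.
  (* Placing [B] in the free slot [n] turns the intersection into a single cylinder, to which mutual
     independence applies. *)
  pose D m := if m == n then B else C m.
  have -> : \bigcap_(m in [set: 'I_N]) (V m @^-1` C m) `&` V n @^-1` B =
      \bigcap_(m in [set: 'I_N]) (V m @^-1` D m).
    rewrite /D; apply/seteqP; split => [w [Cw Bw] k _ /=|w Dw].
      by case: eqP => [->//|_]; exact: (Cw k).
    split => [k _ /=|]; last by have := Dw n I; rewrite /= eqxx.
    by have := Dw k I => /=; case: eqP => // ->; rewrite nC.
  rewrite indV; last by move=> m; rewrite /D; case: ifP.
  rewrite indV//.
  rewrite (bigD1 n)//= [in RHS](bigD1 n)//= nC preimage_setT.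
  rewrite [P setT]probability_setT mul1e /D eqxx; congr (_ * _)%E.
  by apply: eq_bigr => m /negbTE ->.
- move=> k; apply: (@le_lt_trans _ _ 1%E); last by rewrite ltry.
  by rewrite -[leLHS]/(P (setT `&` V n @^-1` B)) setTI; apply: probability_le1;
    exact: mVB.
- exact: sG.
Qed.

Lemma integral_sigma_of_independent n s A
    (h : g_sigma_algebraType (sigma_gen s) * R -> \bar R) :
  mutually_independent P V -> n \notin s -> sigma_of V s A ->
  measurable_fun setT h -> (forall z, 0 <= h z)%E ->
  (\int[P]_(w in A) h (w, V n w) =
   \int[P]_(w in A) \int[P]_w' h (w, V n w'))%E.
Proof.
move=> indV ns sA mh h0.
(* The first random element is the identity of [T] into [T] with the smaller sigma-algebra, so that
   [h] may depend on all the prices in [s] at once. *)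
have mid : measurable_fun setT (id : T -> g_sigma_algebraType (sigma_gen s)).
  by move=> _ B sB; rewrite setTI; apply: (@measurable_sigma_of s).
pose X := mfun_Sub (mem_set mid) : {mfun T >-> g_sigma_algebraType _}.
pose Y := mfun_Sub (mem_set (mV n)) : {mfun T >-> R}.
(* The restriction to [A] becomes an indicator of the first coordinate. *)
pose hA z := (h z * (\1_A z.1)%:E)%E.
have mA : measurable A by exact: measurable_sigma_of sA.
rewrite (integral_mkcond A) [RHS](integral_mkcond A).
have H := @integral_independent_pair _ _ _ _ _ _ _ P X Y _ hA.
rewrite /hA /= in H.
transitivity (\int[P]_w (h (w, V n w) * (\1_A w)%:E))%E.
  by apply: eq_integral => w _; rewrite /patch indicE;
     case: ifP => _; rewrite ?mule1 ?mule0.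
rewrite H; first last.
- by move=> z; rewrite mule_ge0// lee_fin.
- apply: emeasurable_funM => //; apply/measurable_EFinP.
  apply: (measurableT_comp _ measurable_fst).
  by apply: measurable_indic.
- by move=> B C sB mC; exact: (sigma_of_independent n s).
apply: eq_integral => w _; rewrite /patch indicE; case: ifP => _.
  by apply: eq_integral => w' _; rewrite mule1.
by apply: integral0_eq => w' _; rewrite mule0.
Qed.
End SigmaOf.

Lemma measurable_bigmine {d : measure_display} {T : measurableType d}
    {R : realType} {I : Type} (r : seq I) (Q : pred I) (F : I -> T -> \bar R) :
  (forall i, Q i -> measurable_fun setT (F i)) ->
  measurable_fun setT (fun w => \big[Order.min/+oo%E]_(i <- r | Q i) F i w).
Proof.
move=> mF; elim: r => [|i r IH].
  by under eq_fun do rewrite big_nil; exact: measurable_cst.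
under eq_fun do rewrite big_cons.
by case: (boolP (Q i)) => Qi //; apply: measurable_mine => //; exact: mF.
Qed.

(** * Potentials, and the effect of one action on a history event *)

Section Run.
Context {d : measure_display} {T : measurableType d} {R : realType} {N : nat}.
Variables (P : probability T R) (c : 'I_N -> R) (V : 'I_N -> T -> R).
Hypotheses (c0 : forall n, 0 <= c n) (V0 : forall n w, 0 <= V n w).
Hypothesis mV : forall n, measurable_fun setT (V n).
Hypothesis iV : forall n, P.-integrable setT (EFin \o V n).
Hypothesis indV : mutually_independent P V.

Let W n := W_NOI P (c n) (V n).

Let mW n : measurable_fun setT (W n).
Proof. exact: measurable_W_NOI. Qed.

Let W0 n w : (0 <= W n w)%E.
Proof. exact: W_NOI_ge0. Qed.

Let mEV n : measurable_fun setT (fun w => (V n w)%:E).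
Proof. exact/measurable_EFinP. Qed.

Definition surrogate (s : seq 'I_N) (m : 'I_N) (w : T) : \bar R :=
  if m \in s then (V m w)%:E else W_NOI P (c m) (V m) w.

Lemma surrogate_ge0 s m w : (0 <= surrogate s m w)%E.
Proof. by rewrite /surrogate; case: ifP => _; rewrite ?lee_fin ?V0// W0. Qed.

Lemma measurable_surrogate s m : measurable_fun setT (surrogate s m).
Proof. by rewrite /surrogate; case: (m \in s) => //; exact: mW. Qed.

Definition potential (s : seq 'I_N) (w : T) : \bar R :=
  \big[Order.min/+oo%E]_(m < N) surrogate s m w.

Definition rest (s : seq 'I_N) (n : 'I_N) (w : T) : \bar R :=
  \big[Order.min/+oo%E]_(m < N | m != n) surrogate s m w.

Lemma potential_ge0 s w : (0 <= potential s w)%E.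
Proof. by apply: le_bigmin => // m _; exact: surrogate_ge0. Qed.

Lemma rest_ge0 s n w : (0 <= rest s n w)%E.
Proof. by apply: le_bigmin => // m _; exact: surrogate_ge0. Qed.

Lemma measurable_potential s : measurable_fun setT (potential s).
Proof. by apply: measurable_bigmine => m _; exact: measurable_surrogate. Qed.

Lemma measurable_rest s n : measurable_fun setT (rest s n).
Proof. by apply: measurable_bigmine => m _; exact: measurable_surrogate. Qed.

Lemma potential_notin s n w : n \notin s ->
  potential s w = mine (rest s n w) (W n w).
Proof.
by move=> ns; rewrite /potential (bigminD1 n)// minC {2}/surrogate (negbTE ns).
Qed.

Lemma potential_rcons s n w :
  potential (rcons s n) w = mine (rest s n w) (V n w)%:E.
Proof.
rewrite /potential (bigminD1 n)// minC {2}/surrogate mem_rcons inE eqxx.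
congr mine; apply: eq_bigr => m mn.
by rewrite /surrogate mem_rcons inE (negbTE mn).
Qed.

(** [rest s n] also reads surrogates of uninspected items, so the sigma-algebra of [s] is too small
    for it. That of all items except [n] suffices and is still independent of [V n]. *)
Let others n := [seq m <- enum 'I_N | m != n].

Let notin_others n : n \notin others n.
Proof. by rewrite mem_filter eqxx. Qed.

Let in_others m n : m != n -> m \in others n.
Proof. by move=> mn; rewrite mem_filter mn mem_enum. Qed.

Let sigma_of_others {s n A} : n \notin s -> sigma_of V s A ->
  sigma_of V (others n) A.
Proof.
move=> ns; apply: sub_sigma_of => m ms; apply: in_others.
by apply: contraNneq ns => <-.
Qed.

Let measurable_rest_others s n : measurable_fun
  (setT : set (g_sigma_algebraType (sigma_gen V (others n)))) (rest s n).
Proof.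
apply: measurable_bigmine => m /in_others mn.
have mVm := sigma_of_measurable_coord V _ _ mn.
rewrite /surrogate; case: (m \in s); first exact/measurable_EFinP.
have [phi [mphi _ phiE]] := W_NOI_comp P _ _ (c0 m) (mV m) (V0 m) (iV m).
rewrite (_ : W_NOI P (c m) (V m) = phi \o V m).
  exact: (measurableT_comp mphi mVm).
by apply/funext => w /=.
Qed.

Let measurable_integral_rest s n (f : T -> \bar R) : measurable_fun setT f ->
  (forall w, 0 <= f w)%E ->
  measurable_fun setT (fun w => \int[P]_w' mine (rest s n w) (f w'))%E.
Proof.
move=> mf f0.
pose h (z : T * T) := mine (rest s n z.1) (f z.2).
have mh : measurable_fun setT h.
  apply: measurable_mine.
    exact: (measurableT_comp (measurable_rest s n) measurable_fst).
  exact: (measurableT_comp mf measurable_snd).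
have h0 z : (0 <= h z)%E by rewrite le_min rest_ge0 f0.
exact: (@measurable_fun_fubini_tonelli_F _ _ _ _ _ P h mh h0).
Qed.

(** Independence lets [V n] be integrated first with [rest s n w] frozen, and the one-item
    inequality applies with that value as outside option. *)
Lemma integral_inspect_le s n A : n \notin s -> sigma_of V s A ->
  (\int[P]_(w in A) mine (rest s n w) (W n w) <=
   \int[P]_(w in A) mine (rest s n w) (V n w)%:E + (c n)%:E * P A)%E.
Proof.
move=> ns sA.
have mA : measurable A by exact: measurable_sigma_of sA.
have sA' := sigma_of_others ns sA.
have [phi [mphi phi0 phiE]] := W_NOI_comp P _ _ (c0 n) (mV n) (V0 n) (iV n).
pose S := g_sigma_algebraType (sigma_gen V (others n)).
have mrest : measurable_fun setT (fun z : S * R => rest s n z.1).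
  exact: (measurableT_comp (measurable_rest_others s n) measurable_fst).
pose h1 (z : S * R) := mine (rest s n z.1) (phi z.2).
(* The truncation at 0 makes [h2] nonnegative on the whole product; it is invisible at actual
   prices. *)
pose h2 (z : S * R) := mine (rest s n z.1) (Num.max z.2 0)%:E.
have mh1 : measurable_fun setT h1.
  apply: measurable_mine => //.
  exact: (measurableT_comp mphi measurable_snd).
have mh2 : measurable_fun setT h2.
  apply: measurable_mine => //; apply/measurable_EFinP.
  by apply: measurable_maxr => //; exact: measurable_snd.
have h10 z : (0 <= h1 z)%E by rewrite le_min rest_ge0 phi0.
have h20 z : (0 <= h2 z)%E.
  by rewrite le_min rest_ge0 lee_fin le_max lexx orbT.
have ns' := notin_others n.
have := integral_sigma_of_independent P V mV _ _ _ h1 indV ns' sA' mh1 h10.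
have := integral_sigma_of_independent P V mV _ _ _ h2 indV ns' sA' mh2 h20.
rewrite /h1 /h2 /=.
under eq_integral do rewrite max_l ?V0//.
under [in RHS]eq_integral do under eq_integral do rewrite max_l ?V0//.
move=> E2.
under eq_integral do rewrite -phiE.
under [in RHS]eq_integral do under eq_integral do rewrite -phiE.
move=> E1.
rewrite E1 E2 -(integral_cst P mA (c n)%:E) -ge0_integralD//; last 3 first.
- move=> w _; apply: integral_ge0 => w' _.
  by rewrite le_min rest_ge0 lee_fin V0.
- apply: measurable_funTS.
  by apply: measurable_integral_rest => // w; rewrite ?lee_fin ?V0 ?W0.
- by move=> w _; rewrite lee_fin.
apply: ge0_le_integral => //.
- by move=> w _; apply: integral_ge0 => w' _; rewrite le_min rest_ge0 W0.
- apply: measurable_funTS.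
  exact: (measurable_integral_rest s n _ (mW n) (W0 n)).
- apply: emeasurable_funD => //; apply: measurable_funTS.
  by apply: measurable_integral_rest => // w; rewrite ?lee_fin ?V0 ?W0.
- by move=> w _; apply: integral_min_W_NOI_le => //; exact: rest_ge0.
Qed.

(** The event is independent of the uninspected item, so both integrands may be replaced by their
    means. *)
Lemma integral_select_le s n A : n \notin s -> sigma_of V s A ->
  (\int[P]_(w in A) W n w <= \int[P]_(w in A) (V n w)%:E)%E.
Proof.
move=> ns sA.
have mA : measurable A by exact: measurable_sigma_of sA.
have [phi [mphi phi0 phiE]] := W_NOI_comp P _ _ (c0 n) (mV n) (V0 n) (iV n).
pose S := g_sigma_algebraType (sigma_gen V s).
pose h1 (z : S * R) := phi z.2.
pose h2 (z : S * R) := (Num.max z.2 0)%:E.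
have mh1 : measurable_fun setT h1.
  exact: (measurableT_comp mphi measurable_snd).
have mh2 : measurable_fun setT h2.
  apply/measurable_EFinP.
  by apply: measurable_maxr => //; exact: measurable_snd.
have h20 z : (0 <= h2 z)%E by rewrite lee_fin le_max lexx orbT.
have := integral_sigma_of_independent P V mV _ _ _ h2 indV ns sA mh2 h20.
have h10 z : (0 <= h1 z)%E by exact: phi0.
have := integral_sigma_of_independent P V mV _ _ _ h1 indV ns sA mh1 h10.
rewrite /h1 /h2 /=.
under eq_integral do rewrite -phiE.
under [in RHS]eq_integral do under eq_integral do rewrite -phiE.
move=> E1.
under eq_integral do rewrite max_l ?V0//.
under [in RHS]eq_integral do under eq_integral do rewrite max_l ?V0//.
move=> E2.
rewrite E1 E2.
apply: ge0_le_integral => //.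
- by move=> w _; apply: integral_ge0 => w' _; exact: W0.
- by move=> w _; exact: integral_W_NOI_le_mean.
Qed.

(** * Induction on the remaining rounds of a fixed policy *)

Section Policy.
Variable pi : policy R N.
Hypotheses (vpi : valid_policy pi) (mpi : measurable_policy V pi).

(** Actions are indexed by a finite type so that integrals can be summed over the next action. *)
Let dec (i : bool * 'I_N) : action N :=
  if i.1 then Inspect i.2 else Select i.2.

Let dec_inj : injective dec.
Proof. by move=> [[] n] [[] m] //= [->]. Qed.

Let decK a : exists i, dec i = a.
Proof. by case: a => n; [exists (true, n)|exists (false, n)]. Qed.

Let event s i := [set w | pi (observe V s w) = dec i].

Let measurable_event s i : measurable (event s i).
Proof. by apply: (measurable_sigma_of V mV s); exact: mpi. Qed.

(** The run resumes with [k] rounds left, and its final history still contains [s], so inspections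
    already paid for are counted. *)
Definition cost_from (k : nat) (s : seq 'I_N) (w : T) : R :=
  let hs := run pi (fun n => V n w) k (observe V s w) in
  \sum_(p <- hs.1) c p.1 + (match hs.2 with Some n => V n w | None => 0 end).

Lemma cost_from_ge0 k s w : 0 <= cost_from k s w.
Proof.
rewrite /cost_from addr_ge0//; first exact: sumr_ge0.
by case: (run _ _ _ _).2.
Qed.

Lemma cost_from_inspect k s n w : pi (observe V s w) = Inspect n ->
  cost_from k.+1 s w = cost_from k (rcons s n) w.
Proof. by rewrite /cost_from /= => ->; rewrite /observe map_rcons. Qed.

Lemma cost_from_select k s n w : pi (observe V s w) = Select n ->
  cost_from k.+1 s w = \sum_(m <- s) c m + V n w.
Proof. by rewrite /cost_from /= => ->; rewrite /observe big_map. Qed.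

Lemma inspect_notin s n w : pi (observe V s w) = Inspect n -> n \notin s.
Proof. by move/vpi; rewrite /observe -map_comp map_id. Qed.

Lemma measurable_cost_from k s : uniq s -> (size s + k)%N = N.+1 ->
  measurable_fun setT (cost_from k s).
Proof.
elim: k s => [|k IH] s us sk.
  (* Without rounds left, [s] would hold [N.+1] distinct items out of [N]; hence the default cost of
     an unfinished run never arises. *)
  have := max_card (mem s); rewrite (card_uniqP us) card_ord.
  by rewrite addn0 in sk; rewrite sk ltnn.
move=> _ B mB; rewrite setTI.
(* On each event fixing the next action, the cost coincides with a function already known to be
   measurable. *)
rewrite (_ : _ @^-1` _ =
    \bigcup_(i in [set: bool * 'I_N]) (event s i `&` cost_from k.+1 s @^-1` B)).
  apply: fin_bigcup_measurable => // -[b n] _.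
  have preimg g : measurable_fun setT g ->
      (forall w, event s (b, n) w -> cost_from k.+1 s w = g w) ->
      measurable (event s (b, n) `&` cost_from k.+1 s @^-1` B).
    move=> mg eg; rewrite (_ : _ `&` _ = event s (b, n) `&` g @^-1` B).
      apply: measurableI => //.
      by rewrite -[X in measurable X]setTI; exact: mg.
    by apply/seteqP; split => w /= [ew]; [rewrite eg|rewrite -eg].
  case: b preimg => preimg.
    case: (boolP (n \in s)) => ns.
      rewrite (_ : _ `&` _ = set0)//; apply/seteqP; split => w //= [ew _].
      by move: (inspect_notin _ _ _ ew); rewrite ns.
    apply: (preimg (cost_from k (rcons s n))).
      by apply: IH; rewrite ?rcons_uniq ?ns// size_rcons addSnnS.
    by move=> w ew; exact: cost_from_inspect.
  apply: (preimg (fun w => \sum_(m <- s) c m + V n w)).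
    exact: measurable_funD.
  by move=> w ew; exact: cost_from_select.
apply/seteqP; split => [w Bw|w [i _ []]//].
by have [i iE] := decK (pi (observe V s w)); exists i.
Qed.

Let integral_event s A (f : T -> \bar R) : measurable A ->
  measurable_fun setT f -> (forall w, 0 <= f w)%E ->
  (\int[P]_(w in A) f w =
   \sum_(i : bool * 'I_N) \int[P]_(w in A `&` event s i) f w)%E.
Proof.
move=> mA mf f0.
rewrite -ge0_integral_bigsetU//.
- congr (integral P _ f); rewrite -bigcup_seq; apply/seteqP.
  split => [w Aw|w [i _ []]//].
  have [i iE] := decK (pi (observe V s w)).
  by exists i => //=; exact: mem_index_enum.
- by move=> i; exact: measurableI.
- exact: index_enum_uniq.
- move=> i j _ _ [w [[_ ei] [_ ej]]]; apply: dec_inj.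
  by rewrite -ei -ej.
- exact: measurable_funTS.
Qed.

(* [A] need not be contained in the event that the policy reaches the history
   [observe V s w]: [cost_from] restarts the policy from that history anyway. *)
Lemma integral_potential_le k s A : uniq s -> (size s + k)%N = N.+1 ->
  sigma_of V s A ->
  (\int[P]_(w in A) ((\sum_(m <- s) c m)%:E + potential s w) <=
   \int[P]_(w in A) (cost_from k s w)%:E)%E.
Proof.
elim: k s A => [|k IH] s A us sk sA.
  have := max_card (mem s); rewrite (card_uniqP us) card_ord.
  by rewrite addn0 in sk; rewrite sk ltnn.
have mA : measurable A by exact: measurable_sigma_of sA.
have mcost := measurable_cost_from _ _ us sk.
have C0 : 0 <= \sum_(m <- s) c m by exact: sumr_ge0.
rewrite (integral_event s)//; last 2 first.
- by apply: emeasurable_funD => //; exact: measurable_potential.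
- by move=> w; rewrite adde_ge0// ?potential_ge0// lee_fin.
rewrite [leRHS](integral_event s)//; last 2 first.
- exact/measurable_EFinP.
- by move=> w; rewrite lee_fin cost_from_ge0.
apply: lee_sum => i _.
have mF : measurable (A `&` event s i) by exact: measurableI.
have sF : sigma_of V s (A `&` event s i).
  exact: (@measurableI _ (g_sigma_algebraType (sigma_gen V s)) _ _ sA
    (mpi s _)).
rewrite ge0_integralD//; first last.
- by apply: measurable_funTS; exact: measurable_potential.
- by move=> w _; exact: potential_ge0.
rewrite integral_cst//.
case: i mF sF => [[] n] mF sF; last first.
  rewrite [leRHS](_ : _ = \int[P]_(w in A `&` event s (false, n))
      ((\sum_(m <- s) c m)%:E + (V n w)%:E))%E; last first.
    apply: eq_integral => w; rewrite inE => -[_ ew].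
    by rewrite (cost_from_select _ _ _ _ ew).
  rewrite ge0_integralD//; last 2 first.
  - by move=> w _; rewrite lee_fin V0.
  - exact: measurable_funTS.
  rewrite integral_cst//; apply: leeD2l.
  (* Selecting [n] pays at least its entry in the potential: exactly the price if [n] was inspected,
     and otherwise a surrogate of no larger integral. *)
  have le_sur : (\int[P]_(w in A `&` event s (false, n)) potential s w <=
      \int[P]_(w in A `&` event s (false, n)) surrogate s n w)%E.
    apply: ge0_le_integral => //.
    - by move=> w _; exact: potential_ge0.
    - by apply: measurable_funTS; exact: measurable_potential.
    - by apply: measurable_funTS; exact: measurable_surrogate.
    - by move=> w _; exact: bigmin_le.
  apply: (le_trans le_sur); rewrite /surrogate.
  case: (boolP (n \in s)) => ns //.
  exact: integral_select_le ns sF.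
(* A valid policy never inspects an item twice, so this event is empty when [n] is in [s]. *)
case: (boolP (n \in s)) => ns.
  rewrite (_ : A `&` event s (true, n) = set0).
    by rewrite !integral_set0 measure0 mule0 adde0.
  apply/seteqP; split => w //= [_ ew].
  by move: (inspect_notin _ _ _ ew); rewrite ns.
rewrite [leRHS](_ : _ = \int[P]_(w in A `&` event s (true, n))
    (cost_from k (rcons s n) w)%:E)%E; last first.
  apply: eq_integral => w; rewrite inE => -[_ ew].
  by rewrite (cost_from_inspect _ _ _ _ ew).
apply: (le_trans _ (IH (rcons s n) _ _ _ _)); first last.
- by apply: sub_sigma_of sF => m ms; rewrite mem_rcons inE ms orbT.
- by rewrite size_rcons addSnnS.
- by rewrite rcons_uniq ns.
rewrite ge0_integralD//; first last.
- by apply: measurable_funTS; exact: measurable_potential.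
- by move=> w _; exact: potential_ge0.
- by move=> w _; rewrite lee_fin sumr_ge0.
rewrite integral_cst// -cats1 big_cat big_seq1 cats1 EFinD muleDl//; last first.
  exact: fin_num_measure.
(* The costs of [s] cancel; what remains compares the potentials before and after inspecting [n],
   with [c n] charged on this event. *)
rewrite -addeA; apply: leeD2l; rewrite addeC.
rewrite (eq_integral (fun w => mine (rest s n w) (W n w))); last first.
  by move=> w _; rewrite (potential_notin _ _ _ ns).
rewrite [in leRHS](eq_integral (fun w => mine (rest s n w) (V n w)%:E)).
  exact: integral_inspect_le.
by move=> w _; rewrite potential_rcons.
Qed.
End Policy.
End Run.

Theorem mainTheorem2 (d : measure_display) (T : measurableType d) (R : realType)
  (P : probability T R) (N : nat) (c : 'I_N -> R) (V : 'I_N -> {RV P >-> R}) :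
  (forall n, 0 <= c n) ->
  (forall n w, 0 <= V n w) ->
  (forall n, P.-integrable [set: T] (EFin \o V n)) ->
  mutually_independent P (fun n => (V n : T -> R)) ->
  (forall pi : policy R N,
     valid_policy pi -> measurable_policy (fun n => (V n : T -> R)) pi ->
     (\int[P]_w (\big[Order.min/+oo%E]_(n < N) W_NOI P (c n) (V n) w)
        <= expected_cost P c (fun n => (V n : T -> R)) pi)%E) /\
  (\int[P]_w (\big[Order.min/+oo%E]_(n < N) W_NOI P (c n) (V n) w)
     <= ereal_inf [set expected_cost P c (fun n => (V n : T -> R)) pi
                  | pi in [set pi : policy R N | valid_policy pi /\
                           measurable_policy (fun n => (V n : T -> R)) pi]])%E.
Proof.
move=> c0 V0 iV indV.
have lower_bound (pi : policy R N) : valid_policy pi ->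
    measurable_policy (fun n => (V n : T -> R)) pi ->
    (\int[P]_w (\big[Order.min/+oo%E]_(n < N) W_NOI P (c n) (V n) w)
       <= expected_cost P c (fun n => (V n : T -> R)) pi)%E.
  move=> vpi mpi.
  have mV n : measurable_fun setT (V n : T -> R) by exact: measurable_funPT.
  (* With [N.+1] rounds and an empty history, [cost_from] is the full cost and the potential is the
     minimum of the surrogates. *)
  have := @integral_potential_le _ _ _ _ P c _ c0 V0 mV iV indV _ vpi mpi
    N.+1 [::] setT erefl erefl.
  rewrite big_nil; under eq_integral do rewrite add0e.
  by apply; exact: (@measurableT _ (g_sigma_algebraType _)).
split => //.
by apply: le_ereal_inf_tmp => _ [pi [vpi mpi] <-]; exact: lower_bound.
Qed.
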